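(* Let $d\ge 1$ be an integer. There does not exist a randomized online algorithm for the $d$-bounded online Ad-auctions problem with competitive ratio strictly better than $1-\left(1-\frac{1}{d}\right)^d$; that is, for every $c>1-\left(1-\frac{1}{d}\right)^d$ there is no randomized online algorithm $ALG$ and constant $a$ such that $\mathbb{E}[ALG(\sigma)]\ge c\cdot OPT(\sigma)-a$ for every input $\sigma$.
   Context: The $d$-bounded online Ad-auctions problem: there are $n$ bidders known in advance, bidder $i$ having a budget $B(i)\ge 0$. Products arrive online one at a time; for each arriving product $j$, at most $d$ bidders are interested in it, and each interested bidder $i$ submits a bid $b_{i,j}\ge 0$. Upon arrival, the algorithm must irrevocably allocate product $j$ to (at most) one interested bidder $i$, gaining revenue $b_{i,j}$, with the constraint that no bidder is charged more than its budget in total (i.e. the total revenue collected from bidder $i$ is at most $B(i)$). The goal is to maximize total revenue. $OPT(\sigma)$ is the maximum revenue achievable by an offline allocation knowing the whole input $\sigma$, and $ALG(\sigma)$ is the revenue of the online algorithm (a random variable for randomized algorithms). For this maximization problem, a randomized algorithm is $c$-competitive if $\mathbb{E}[ALG(\sigma)]\ge c\cdot OPT(\sigma)-a$ for all inputs $\sigma$, for some constant $a$. *)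

(* Defs.v *)
From HB Require Import structures.
From mathcomp Require Import all_boot all_order all_algebra.
From mathcomp Require Import all_classical all_reals all_analysis.

Set Implicit Arguments.
Unset Strict Implicit.
Unset Printing Implicit Defensive.

Import Order.TTheory GRing.Theory Num.Theory.

Local Open Scope classical_set_scope.
Local Open Scope ring_scope.

(* A product is its bid vector: [Some b] is the bid [b] of an interested
   bidder, [None] marks a bidder that is not interested.  An interested bidder
   may bid [0]. *)
Definition product (R : realType) (n : nat) := {ffun 'I_n -> option R}.

(* Products are listed in their order of arrival. *)
Record input (R : realType) := Input {
  bidders : nat;
  budget : {ffun 'I_bidders -> R};
  products : seq (product R bidders)
}.

Section Inputs.
Context {R : realType}.
Implicit Types s : input R.

Definition nth_product s (j : 'I_(size (products s))) : product R (bidders s) :=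
  tnth (in_tuple (products s)) j.

Definition interested s (i : 'I_(bidders s)) (j : 'I_(size (products s))) : bool :=
  isSome (nth_product j i).

Definition bid s (i : 'I_(bidders s)) (j : 'I_(size (products s))) : R :=
  odflt 0 (nth_product j i).

Definition d_bounded (d : nat) s : Prop :=
  [/\ forall i, 0 <= budget s i,
      forall i j, @interested s i j -> 0 <= bid i j
    & forall j, (#|[set i | @interested s i j]%SET| <= d)%N].

(* [None] means that the product is left unallocated. *)
Definition allocation s :=
  {ffun 'I_(size (products s)) -> option 'I_(bidders s)}.

(* Budgets are hard constraints: the bids collected from a bidder must sum to
   at most its budget. *)
Definition feasible s (x : allocation s) : bool :=
  [forall j, if x j is Some i then interested i j else true] &&
  [forall i, \sum_(j | x j == Some i) bid i j <= budget s i].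

Definition revenue s (x : allocation s) : R :=
  \sum_j (if x j is Some i then bid i j else 0).

(* When budgets are nonnegative the empty allocation is feasible with revenue
   [0], so the default value [0] does not alter the maximum. *)
Definition OPT s : R :=
  \big[Num.max/0]_(x : allocation s | feasible x) revenue x.

Definition revealed s (j : nat) : input R :=
  Input (budget s) (take j.+1 (products s)).

End Inputs.

(* The argument is what has been revealed so far: all the budgets and the
   products up to and including the one to be allocated now, which comes last.
   Earlier decisions are determined by this history, so they are not passed
   separately. *)
Definition det_algorithm (R : realType) :=
  forall s : input R, option 'I_(bidders s).

Definition run (R : realType) (A : det_algorithm R) (s : input R) :
    allocation s :=
  [ffun j : 'I_(size (products s)) => A (revealed s j)].

(* A randomized algorithm is a random deterministic one.  No sigma-algebra is
   put on [det_algorithm]: all that is required is that, on each input, the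
   allocation produced (which ranges over a finite set) be a random element. *)
Record rand_algorithm (R : realType) (d : nat) := RandAlgorithm {
  coins_display : measure_display;
  coins : measurableType coins_display;
  coins_law : probability coins R;
  strategy : coins -> det_algorithm R;
  strategy_feasible : forall (s : input R) (w : coins),
    d_bounded d s -> feasible (run (strategy w) s);
  strategy_measurable : forall (s : input R) (x : allocation s),
    d_bounded d s -> measurable [set w | run (strategy w) s = x]
}.

Definition ALG (R : realType) (d : nat) (A : rand_algorithm R d) (s : input R)
    (w : coins A) : R :=
  revenue (run (strategy w) s).

Definition competitive (R : realType) (d : nat) (A : rand_algorithm R d)
    (c : R) : Prop :=
  exists a : R, forall s : input R, d_bounded d s ->
    ((c * OPT s - a)%:E <= 'E_(coins_law A)[ALG s])%E.

(* Main.v *)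
(* Take d ^ d bidders, all budgets and all bids equal to M.  In each of d phases
   the adversary groups the active bidders by d, offers one product to each
   group, and then retires the member of the group with the least expected
   load; after the d phases each remaining bidder is offered one product alone.
   The optimum gives every product to the bidder retired by it and so exhausts
   all budgets.  Write N = d ^ d, q = 1 - 1/d, and count loads in units of M.
   After k phases N q^k bidders are active, the total expected load T_k is at
   most the number N (1 - q^k) of products, and retiring the least loaded
   members makes the expected load D_k of the retired bidders satisfy
   d D_k <= (d - 1) D_(k-1) + T_k, whence D_k <= N (1 - q^k (1 + k/d)).  The
   algorithm thus collects at most D_d + N q^d <= N (1 - q^d) in expectation,
   against N for the optimum, and letting M grow defeats the additive constant.
   Only expected loads matter, so the adversary can be deterministic. *)

Require Import Defs.
From HB Require Import structures.
From mathcomp Require Import all_boot all_order all_algebra.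
From mathcomp Require Import all_classical all_reals all_analysis.
From mathcomp Require Import measurable_realfun ring lra.
Import Order.TTheory GRing.Theory Num.Theory.
Local Open Scope ring_scope.

Set Implicit Arguments.
Unset Strict Implicit.
Unset Printing Implicit Defensive.

(** * The adversary against a fractional matching *)

Section Adversary.
Context {R : realType} {T : finType}.
Implicit Types (F : seq {set T} -> T -> R) (sl : seq {set T})
  (pl : seq ({set T} * T)) (d : nat).

(* [F sl i] stands for the probability that the last product of the sequence
   [sl] goes to bidder [i]; a product is the set of its interested bidders. *)
Definition load F sl i : R := \sum_(j < size sl) F (take j.+1 sl) i.

Definition d_small d sl := all (fun S : {set T} => #|S| <= d)%N sl.

(** What remains of a randomized algorithm after averaging over its coins, with loads in units of
    the common budget. The conditions are limited to [d_small] sequences because an algorithm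
    promises nothing on other inputs. *)
Record fractional_matching d F : Prop := FractionalMatching {
  supply_le1 : forall sl S, d_small d (rcons sl S) ->
    \sum_i F (rcons sl S) i <= 1;
  uninterested0 : forall sl S i, d_small d (rcons sl S) -> i \notin S ->
    F (rcons sl S) i = 0;
  load_le1 : forall sl i, d_small d sl -> load F sl i <= 1 }.

(* The second components are the bidders retired by the products offered so
   far; they form a matching that saturates these products. *)
Definition planned d pl :=
  [&& uniq (unzip2 pl), d_small d (unzip1 pl) &
      all (fun p : {set T} * T => p.2 \in p.1) pl].

Definition retired_load F pl := \sum_(i <- unzip2 pl) load F (unzip1 pl) i.

Lemma load_rcons F sl S i :
  load F (rcons sl S) i = load F sl i + F (rcons sl S) i.
Proof.
rewrite /load size_rcons big_ord_recr /=; congr (_ + _); last first.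
  by rewrite -(size_rcons sl S) take_size.
by apply: eq_bigr => j _; rewrite -cats1 takel_cat.
Qed.

Lemma exists_le_average (G : {set T}) (f : T -> R) : (0 < #|G|)%N ->
  exists2 i, i \in G & #|G|%:R * f i <= \sum_(k in G) f k.
Proof.
case/card_gt0P => i0 Gi0; case: (arg_minP f Gi0) => i Gi min_i.
exists i => //; rewrite mulrC mulr_natr -sumr_const.
exact: ler_sum.
Qed.

Lemma exists_subset_card (U : {set T}) e : (e <= #|U|)%N ->
  exists2 G : {set T}, G \subset U & #|G| = e.
Proof.
move=> leU; exists [set i in take e (enum U)]%SET.
  by apply/fintype.subsetP => i; rewrite inE => /mem_take; rewrite mem_enum.
rewrite cardsE (card_uniqP _) ?take_uniq ?enum_uniq //.
by rewrite size_takel // -cardE.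
Qed.

(** Induction on the number [m] of groups. The minimum of a group is at most its average, so [e]
    times the load of the retired member is at most the load of the group before the offer plus the
    share just handed out. Summing over the groups gives the last bound. Phases use [e = d], the
    final round [e = 1]. *)
Lemma adversary_phase {d F} e m pl (U : {set T}) :
    fractional_matching d F -> (0 < e <= d)%N -> planned d pl ->
    {in U, forall i, i \notin unzip2 pl} -> #|U| = (m * e)%N ->
  exists pl', [/\ planned d pl', size pl' = (size pl + m)%N,
    forall i, i \notin U -> load F (unzip1 pl') i = load F (unzip1 pl) i,
    \sum_i load F (unzip1 pl') i <= \sum_i load F (unzip1 pl) i + m%:R &
    e%:R * (retired_load F pl' - retired_load F pl) <=
      \sum_(i in U) load F (unzip1 pl) i +
      (\sum_i load F (unzip1 pl') i - \sum_i load F (unzip1 pl) i)].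
Proof.
move=> FM /andP[e_gt0 le_ed]; elim: m pl U => [|m IHm] pl U plP UP cardU.
  exists pl; split; rewrite ?addn0 ?addr0 ?subrr ?mulr0 //.
  by rewrite (cards0_eq cardU) big_set0.
have [G sGU cardG] : exists2 G : {set T}, G \subset U & #|G| = e.
  by apply: exists_subset_card; rewrite cardU mulSn leq_addr.
set sl := unzip1 pl; have/and3P[uniq_pl small_pl mem_pl] := plP.
have small_G : d_small d (rcons sl G) by rewrite /d_small all_rcons cardG le_ed.
have [x Gx x_min] : exists2 x, x \in G &
    e%:R * load F (rcons sl G) x <= \sum_(k in G) load F (rcons sl G) k.
  by rewrite -cardG; apply: exists_le_average; rewrite cardG.
have unz1 : unzip1 (rcons pl (G, x)) = rcons sl G by rewrite /unzip1 map_rcons.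
have unz2 : unzip2 (rcons pl (G, x)) = rcons (unzip2 pl) x.
  by rewrite /unzip2 map_rcons.
have loadNG i : i \notin G -> load F (rcons sl G) i = load F sl i.
  by move=> iG; rewrite load_rcons (uninterested0 FM) ?addr0.
have Ux : x \in U by apply: (fintype.subsetP sGU).
(* All of [G] is set aside, not only [x]: the load of [x] is then frozen, and the other members wait
   for the next phase. *)
have [] := IHm (rcons pl (G, x)) (U :\: G).
- rewrite /planned unz1 unz2 small_G rcons_uniq uniq_pl UP //=.
  by rewrite all_rcons /= Gx.
- move=> i; rewrite inE => /andP[iG iU]; rewrite unz2 mem_rcons inE negb_or.
  rewrite UP //.
  by rewrite andbT; apply: contraNneq iG => ->.
- by rewrite cardsD (finset.setIidPr sGU) cardU cardG mulSn addKn.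
move=> pl'; rewrite unz1 size_rcons.
move=> -[pl'P size_pl' load_pl' total_pl' ret_pl'].
have total_G : \sum_i load F (rcons sl G) i =
    \sum_i load F sl i + \sum_i F (rcons sl G) i.
  by under eq_bigr do rewrite load_rcons; rewrite big_split.
have supply := supply_le1 FM small_G.
exists pl'; split => //.
- by rewrite size_pl' addSnnS.
- move=> i iU; rewrite load_pl' ?inE ?(negPf iU) ?andbF //.
  by apply: loadNG; apply: contra iU; apply: (fintype.subsetP sGU).
- by rewrite (le_trans total_pl') // total_G -natr1; lra.
have ret_G : retired_load F (rcons pl (G, x)) =
    retired_load F pl + load F (rcons sl G) x.
  rewrite /retired_load unz1 unz2 big_rcons /=; congr (_ + _).
  apply: eq_big_seq => i ipl; apply: loadNG; apply: contraL ipl => iG.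
  by apply: UP; apply: (fintype.subsetP sGU).
have sumU : \sum_(i in U) load F sl i =
    \sum_(i in G) load F sl i + \sum_(i in U :\: G) load F sl i.
  by rewrite (big_setID G) /= (finset.setIidPr sGU).
have sumUG : \sum_(i in U :\: G) load F (rcons sl G) i =
    \sum_(i in U :\: G) load F sl i.
  by apply: eq_bigr => i; rewrite inE => /andP[iG _]; apply: loadNG.
have sumG : \sum_(i in G) load F (rcons sl G) i =
    \sum_(i in G) load F sl i + \sum_i F (rcons sl G) i.
  under eq_bigr do rewrite load_rcons; rewrite big_split /=; congr (_ + _).
  rewrite [RHS](bigID (mem G)) /= [X in _ + X]big1 ?addr0 // => i iG.
  exact: (uninterested0 FM).
rewrite sumUG total_G ret_G in ret_pl'; rewrite sumG in x_min; rewrite sumU.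
move: ret_pl' x_min; rewrite !mulrBr mulrDr; lra.
Qed.

Lemma active_card {d pl} : planned d pl ->
  (#|[set i | i \notin unzip2 pl]%SET| + size pl)%N = #|T|.
Proof.
case/and3P => uniq_pl _ _; rewrite -(size_map snd) -(card_uniqP uniq_pl) addnC.
rewrite -(cardC (mem (unzip2 pl))); congr (_ + _)%N.
by rewrite cardsE; apply: eq_card => i; rewrite !inE.
Qed.

Lemma total_load_split F d pl sl : planned d pl ->
  \sum_i load F sl i = \sum_(i <- unzip2 pl) load F sl i +
    \sum_(i in [set i | i \notin unzip2 pl]%SET) load F sl i.
Proof.
case/and3P => uniq_pl _ _; rewrite (bigID (mem (unzip2 pl))) /= big_uniq //=.
by congr (_ + _); apply: eq_bigl => i; rewrite inE.
Qed.

(** The product [d.-1 ^ k * d ^ (d - k)] counts the active bidders, N q^k, in a form that shows a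
    factor [d] as long as [k < d], so that they split evenly into groups. *)
Lemma adversary_phases d F k : fractional_matching d F -> (0 < d)%N ->
    #|T| = (d ^ d)%N -> (k <= d)%N ->
  exists pl, [/\ planned d pl,
    (size pl + d.-1 ^ k * d ^ (d - k))%N = (d ^ d)%N,
    \sum_i load F (unzip1 pl) i <= #|T|%:R * (1 - (1 - 1 / d%:R) ^+ k) &
    retired_load F pl <=
      #|T|%:R * (1 - (1 - 1 / d%:R) ^+ k * (1 + k%:R / d%:R))].
Proof.
move=> FM d_gt0 cardT; elim: k => [|k IHk] le_kd.
  exists [::]; rewrite /retired_load /= !big_nil expn0 mul1n subn0 add0n.
  rewrite expr0 mul0r addr0 mulr1 subrr mulr0; split => //.
  by rewrite big1 // => i _; rewrite /load big_ord0.
have [pl [plP size_pl total_pl ret_pl]] := IHk (ltnW le_kd).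
have cardU := active_card plP; set U := finset _ in cardU.
set m := (d.-1 ^ k * d ^ (d - k.+1))%N.
have def_m : (d.-1 ^ k * d ^ (d - k) = m * d)%N.
  by rewrite -mulnA -expnSr subnSK.
have [|||pl' [pl'P size_pl' _ total_pl' ret_pl']] :=
  @adversary_phase d F d m pl U FM _ plP.
- by rewrite d_gt0 leqnn.
- by move=> i; rewrite inE.
- rewrite -def_m; apply: (@addIn (size pl)).
  by rewrite cardU cardT -size_pl addnC.
(* The active bidders carry the total load minus the retired load, which turns the bound of the
   phase into d D_(k+1) <= (d - 1) D_k + T_(k+1). *)
have split_pl := total_load_split F (unzip1 pl) plP.
rewrite -/(retired_load F pl) -/U in split_pl.
have d_neq0 : d%:R != 0 :> R by rewrite pnatr_eq0 -lt0n.
have d_pos : 0 < d%:R :> R by rewrite ltr0n.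
have m_eq : m%:R * d%:R = #|T|%:R * (1 - 1 / d%:R) ^+ k :> R.
  have dd : (d ^ d = d ^ k * d ^ (d - k))%N by rewrite -expnD subnKC // ltnW.
  rewrite -natrM -def_m cardT dd !natrM mulrAC; congr (_ * _).
  rewrite !natrX -exprMn; congr (_ ^+ _).
  by rewrite -[in RHS](prednK d_gt0) -natr1; field; rewrite natr1 prednK.
set q := 1 - 1 / d%:R in total_pl ret_pl m_eq *.
set N := #|T|%:R in total_pl ret_pl m_eq *.
have dq : d%:R * q = d%:R - 1 :> R by rewrite /q; field.
have total' : \sum_i load F (unzip1 pl') i <= N * (1 - q ^+ k.+1).
  have -> : N * (1 - q ^+ k.+1) = N * (1 - q ^+ k) + m%:R.
    apply: (mulIf d_neq0); rewrite mulrDl m_eq exprS.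
    ring: dq.
  by lra.
exists pl'; split => //.
  rewrite size_pl' -size_pl def_m -addnA; congr (_ + _)%N.
  by rewrite expnS -mulnA -/m -[in RHS](prednK d_gt0) mulnS mulnC.
rewrite -(ler_pM2l d_pos).
(* The claimed bounds satisfy this recurrence with equality. *)
have -> : d%:R * (N * (1 - q ^+ k.+1 * (1 + k.+1%:R / d%:R))) =
   (d%:R - 1) * (N * (1 - q ^+ k * (1 + k%:R / d%:R))) + N * (1 - q ^+ k.+1).
  by rewrite exprS -dq -natr1; set Q := q ^+ k; rewrite /q; field.
have := ler_wpM2l (_ : 0 <= d%:R - 1 :> R) ret_pl.
rewrite subr_ge0 ler1n => /(_ d_gt0).
move: ret_pl'; rewrite mulrBr; lra.
Qed.

(** At k = d the retired load is at most N (1 - 2 q^d). A last round with singleton groups retires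
    the other N q^d bidders, each of load at most 1, and leaves the earlier loads unchanged. *)
Lemma adversary_bound d F : fractional_matching d F -> (0 < d)%N ->
    #|T| = (d ^ d)%N ->
  exists pl, [/\ planned d pl, size pl = #|T| &
    \sum_i load F (unzip1 pl) i <= #|T|%:R * (1 - (1 - 1 / d%:R) ^+ d)].
Proof.
move=> FM d_gt0 cardT.
have [pl [plP size_pl total_pl ret_pl]] :=
  adversary_phases FM d_gt0 cardT (leqnn d).
have cardU := active_card plP; set U := finset _ in cardU.
have [|||pl' [pl'P size_pl' loadNU _ _]] :=
  @adversary_phase d F 1 #|U| pl U FM _ plP.
- by [].
- by move=> i; rewrite inE.
- by rewrite muln1.
have/and3P[_ small_pl' _] := pl'P.
exists pl'; split => //; first by rewrite size_pl' addnC.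
rewrite (total_load_split F _ plP) -/U.
have -> : \sum_(i <- unzip2 pl) load F (unzip1 pl') i = retired_load F pl.
  by apply: eq_big_seq => i ipl; apply: loadNU; rewrite inE negbK.
have leU : \sum_(i in U) load F (unzip1 pl') i <= #|U|%:R.
  rewrite -[leRHS]mul1r mulr_natr.
  by rewrite -sumr_const; apply: ler_sum => i _; apply: (load_le1 FM).
have d_neq0 : d%:R != 0 :> R by rewrite pnatr_eq0 -lt0n.
have cU : #|U|%:R = #|T|%:R * (1 - 1 / d%:R) ^+ d :> R.
  have -> : #|U| = (d.-1 ^ d)%N.
    apply: (@addIn (size pl)); rewrite cardU cardT -size_pl subnn expn0 muln1.
    by rewrite addnC.
  rewrite cardT !natrX -exprMn; congr (_ ^+ _).
  by rewrite -[in RHS](prednK d_gt0) -natr1; field; rewrite natr1 prednK.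
move: ret_pl; rewrite divff // cU in leU *; lra.
Qed.
End Adversary.

(** * Expected counts of events *)

Section SumOfProbabilities.
Context d (W : measurableType d) (R : realType) (P : probability W R).

Lemma integral_sum_indic (J : finType) (E : J -> set W) (k : R) :
    0 <= k -> (forall j, measurable (E j)) ->
  (\int[P]_w (k * \sum_j \1_(E j) w)%:E)%E = (k * \sum_j fine (P (E j)))%:E.
Proof.
move=> k_ge0 mE.
have mI j : measurable_fun setT (EFin \o (\1_(E j) : W -> R)).
  by apply/measurable_EFinP; apply: measurable_indic.
under eq_integral do rewrite EFinM -sumEFin.
rewrite ge0_integralZl//=; last 2 first.
- by apply: emeasurable_sum.
- by move=> w _; apply: sume_ge0 => j _; rewrite lee_fin.
rewrite ge0_integral_sum//.
rewrite EFinM -sumEFin; congr (_ * _)%E; apply: eq_bigr => j _.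
by rewrite integral_indic// setIT fineK// fin_num_measure.
Qed.

Lemma sum_probability_le (J : finType) (E : J -> set W) (k : R) :
    (forall j, measurable (E j)) -> (forall w, \sum_j \1_(E j) w <= k) ->
  \sum_j fine (P (E j)) <= k.
Proof.
move=> mE le_k; rewrite -lee_fin.
have := integral_sum_indic ler01 mE; rewrite mul1r => <-.
have <- : (\int[P]_w k%:E = k%:E)%E.
  by rewrite integral_cst// [X in (_ * X)%E]probability_setT mule1.
apply: ge0_le_integral => //.
- move=> w _; rewrite mul1r lee_fin; exact: sumr_ge0.
- apply/measurable_EFinP; under eq_fun do rewrite mul1r.
  by apply: measurable_sum => j; apply: measurable_indic.
- by move=> w _; rewrite mul1r lee_fin.
Qed.

End SumOfProbabilities.

(** * Inputs whose budgets and bids all equal M *)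

Section UniformInstances.
Context {R : realType} {n : nat} (M : R) (M_gt0 : 0 < M).
Implicit Type sl : seq {set 'I_n}.

Definition uniform_product (S : {set 'I_n}) : product R n :=
  [ffun i => if i \in S then Some M else None].

Definition uniform_input sl : input R :=
  Input [ffun=> M] (map uniform_product sl).

Lemma nth_uniform sl (j : 'I_(size (products (uniform_input sl)))) :
  nth_product j = uniform_product (nth finset.set0 sl j).
Proof.
rewrite /nth_product (tnth_nth (uniform_product finset.set0)) /=.
by rewrite (nth_map finset.set0) // -(size_map uniform_product).
Qed.

Lemma interested_uniform sl i j :
  @interested R (uniform_input sl) i j = (i \in nth finset.set0 sl j).
Proof. by rewrite /interested nth_uniform ffunE; case: ifP. Qed.

Lemma bid_uniform sl i j :
  @bid R (uniform_input sl) i j = if i \in nth finset.set0 sl j then M else 0.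
Proof. by rewrite /bid nth_uniform ffunE; case: ifP. Qed.

Lemma d_bounded_uniform d sl : d_small d sl -> d_bounded d (uniform_input sl).
Proof.
move=> small_sl; split.
- by move=> i; rewrite ffunE ltW.
- by move=> i j; rewrite bid_uniform; case: ifP => // _ _; rewrite ltW.
- move=> j; have lt_j : (j < size sl)%N by rewrite -(size_map uniform_product).
  apply: leq_trans (all_nthP finset.set0 small_sl j lt_j).
  rewrite leq_eqVlt; apply/orP; left; apply/eqP.
  by apply: eq_card => i; rewrite inE interested_uniform.
Qed.

(** Each product goes to the bidder it retires. These bidders are distinct, so each budget M is
    charged at most once. *)
Lemma OPT_uniform d (pl : seq ({set 'I_n} * 'I_n)) : planned d pl ->
  M * (size pl)%:R <= OPT (uniform_input (unzip1 pl)).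
Proof.
case: pl => [|p0 pl']; first by rewrite mulr0 => _; apply: bigmax_ge_id.
set pl := p0 :: pl' => /and3P[uniq_pl _ mem_pl].
set s := uniform_input _.
have lt_size (j : 'I_(size (products s))) : (j < size pl)%N.
  by apply: leq_trans (ltn_ord j) _; rewrite !size_map.
pose x : allocation s :=
  [ffun j : 'I_(size (products s)) => Some (nth p0 pl j).2].
have mem_x (j : 'I_(size (products s))) :
    (nth p0 pl j).2 \in nth finset.set0 (unzip1 pl) j.
  by rewrite (nth_map p0) //; apply: (all_nthP p0 mem_pl).
have feas_x : feasible x.
  apply/andP; split.
    by apply/forallP => j; rewrite ffunE interested_uniform mem_x.
  apply/forallP => i; rewrite [X in _ <= X]ffunE.
  have [/existsP[j0 /eqP xj0]|/existsPn no_j] := boolP [exists j, x j == Some i].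
    rewrite (bigD1 j0) ?xj0 //= big1 ?addr0.
      by rewrite bid_uniform; case: ifP => // _; rewrite ltW.
    move=> j /andP[/eqP xj]; move: xj xj0; rewrite !ffunE => -[xj] [xj0].
    case/negP; apply/eqP/val_inj/eqP.
    rewrite -(nth_uniq p0.2 _ _ uniq_pl) ?[size (unzip2 pl)]size_map ?lt_size //.
    by rewrite !(nth_map p0) ?lt_size // xj xj0.
  by rewrite big_pred0 ?ltW // => j; apply: negbTE.
apply: le_trans (le_bigmax_cond _ _ feas_x).
rewrite /revenue (eq_bigr (fun=> M)).
  by rewrite sumr_const card_ord size_map size_map mulr_natr.
by move=> j _; rewrite ffunE bid_uniform mem_x.
Qed.

Context {d : nat} (A : rand_algorithm R d).

Definition decision (w : coins A) sl : option 'I_n :=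
  strategy w (uniform_input sl).

Definition allocated sl i := [set w | decision w sl = Some i]%classic.

Definition share sl i : R := fine (coins_law A (allocated sl i)).

(** What is revealed of a uniform input is again a uniform input, so a run is determined by
    [decision] on prefixes. *)
Lemma run_uniform w sl (j : 'I_(size (products (uniform_input sl)))) :
  run (strategy w) (uniform_input sl) j = decision w (take j.+1 sl).
Proof. by rewrite ffunE /decision /uniform_input map_take. Qed.

(** Measurability is given only for whole runs; a single decision is a finite union of such
    events. *)
Lemma measurable_allocated sl j i : d_small d sl -> (j < size sl)%N ->
  measurable (allocated (take j.+1 sl) i).
Proof.
move=> small_sl; rewrite -(size_map uniform_product) => lt_j.
set s := uniform_input sl; pose jo : 'I_(size (products s)) := Ordinal lt_j.
have -> : allocated (take j.+1 sl) i =
    (\bigcup_(x in [set x : allocation s | x jo = Some i])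
      [set w | run (strategy w) s = x])%classic.
  apply/seteqP; split=> w.
    by move=> wi; exists (run (strategy w) s) => //=; rewrite run_uniform.
  by case=> x /= xj runx; move: xj; rewrite -runx run_uniform.
apply: fin_bigcup_measurable => [|x _]; first exact: finite_finset.
exact/strategy_measurable/d_bounded_uniform.
Qed.

Lemma decision_interested w sl j i : d_small d sl -> (j < size sl)%N ->
  decision w (take j.+1 sl) = Some i -> i \in nth finset.set0 sl j.
Proof.
move=> small_sl; rewrite -(size_map uniform_product) => lt_j dec_i.
have/andP[/forallP/(_ (Ordinal lt_j)) + _] :=
  strategy_feasible w (d_bounded_uniform small_sl).
by rewrite run_uniform /= dec_i interested_uniform.
Qed.

Lemma indic_allocated w sl i :
  \1_(allocated sl i) w = (decision w sl == Some i)%:R :> R.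
Proof.
by rewrite indicE; congr (nat_of_bool _)%:R; apply/idP/eqP; rewrite inE.
Qed.

Lemma sum_indic_allocated w sl :
  \sum_i \1_(allocated sl i) w = (decision w sl)%:R :> R.
Proof.
under eq_bigr do rewrite indic_allocated.
case: (decision w sl) => [i0|]; last by rewrite big1.
rewrite (bigD1 i0) //= eqxx big1 ?addr0 // => i i_neq.
by rewrite (inj_eq Some_inj) eq_sym (negPf i_neq).
Qed.

(** A single bid of M already uses up the budget M. *)
Lemma count_allocated_le1 w sl i : d_small d sl ->
  \sum_(j < size sl) \1_(allocated (take j.+1 sl) i) w <= 1 :> R.
Proof.
move=> small_sl; rewrite -(ler_pM2l M_gt0) mulr1.
have/andP[_ /forallP/(_ i)] := strategy_feasible w (d_bounded_uniform small_sl).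
rewrite [leRHS]ffunE; apply: le_trans; rewrite le_eqVlt; apply/orP; left.
rewrite -(size_map uniform_product) mulr_sumr [eqbRHS]big_mkcond /=; apply/eqP.
apply: eq_bigr => j _; rewrite indic_allocated run_uniform.
case: eqP => [dec_i|_]; last by rewrite mulr0.
rewrite bid_uniform (decision_interested small_sl _ dec_i) ?mulr1 //.
by rewrite -(size_map uniform_product).
Qed.

Lemma expected_revenue sl : d_small d sl ->
  ('E_(coins_law A)[@ALG R d A (uniform_input sl)] =
   (M * \sum_i load share sl i)%:E)%E.
Proof.
move=> small_sl; rewrite /load /share.
(* Indexing by pairs makes the double sum one finite sum of indicators. *)
pose E (p : 'I_n * 'I_(size sl)) := allocated (take p.2.+1 sl) p.1.
rewrite (pair_bigA _ (fun i j => fine (coins_law A (E (i, j))))) /=.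
rewrite -(integral_sum_indic _ (E := E)) ?ltW //; last first.
  by move=> p; apply: measurable_allocated.
rewrite unlock; apply: eq_integral => w _; congr (_%:E).
rewrite -(pair_bigA _ (fun i j => \1_(E (i, j)) w)) exchange_big /E /=.
rewrite /ALG /revenue mulr_sumr -(size_map uniform_product).
apply: eq_bigr => j _; rewrite run_uniform sum_indic_allocated.
case dec_j: (decision _ _) => [i|]; last by rewrite mulr0.
rewrite bid_uniform (decision_interested small_sl _ dec_j) ?mulr1 //.
by rewrite -(size_map uniform_product).
Qed.

Lemma fractional_matching_share : fractional_matching d share.
Proof.
(* The facts about decisions concern prefixes [take j.+1 sl]; the full sequence is the last of
   them. *)
have rconsE sl S : rcons sl S = take (size sl).+1 (rcons sl S).
  by rewrite take_oversize ?size_rcons.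
split.
- move=> sl S small_sl; apply: sum_probability_le => [i|w]; last first.
    by rewrite sum_indic_allocated lern1 leq_b1.
  by rewrite rconsE; apply: measurable_allocated; rewrite ?size_rcons.
- move=> sl S i small_sl iS.
  rewrite /share (_ : allocated _ _ = set0) ?measure0 //.
  apply/seteqP; split => // w; rewrite /allocated /= rconsE.
  move/decision_interested; rewrite small_sl size_rcons => /(_ isT (leqnn _)).
  by rewrite nth_rcons ltnn eqxx (negPf iS).
- move=> sl i small_sl; apply: sum_probability_le => [j|w].
    exact: measurable_allocated.
  exact: count_allocated_le1.
Qed.

End UniformInstances.

Theorem theorem2 (R : realType) (d : nat) (hd : (1 <= d)%N) (c : R)
    (hc : 1 - (1 - 1 / d%:R) ^+ d < c) :
  ~ (exists A : rand_algorithm R d, competitive A c).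
Proof.
case=> A [a compA]; set r := 1 - _ in hc; set N := (d ^ d)%N.
have N_gt0 : 0 < N%:R :> R by rewrite ltr0n expn_gt0 hd.
have d_gt0 : 0 < d%:R :> R by rewrite ltr0n.
have r_ge0 : 0 <= r.
  rewrite subr_ge0 exprn_ile1 // ?subr_ge0 ?gerBl ?divr_ge0 ?ler0n //.
  by rewrite ler_pdivrMr // mul1r ler1n.
(* Chosen so that M N (c - r) = |a| + 1 exceeds [a], whereas competitiveness would give c M N - a <=
   r M N. *)
pose M := (`|a| + 1) / (N%:R * (c - r)).
have cr_gt0 : 0 < c - r by rewrite subr_gt0.
have M_gt0 : 0 < M by rewrite divr_gt0 ?mulr_gt0 // ltr_wpDl.
have [pl [plP size_pl load_pl]] :=
  adversary_bound (fractional_matching_share (n := N) M_gt0 A) hd (card_ord N).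
have/and3P[_ small_pl _] := plP.
have := compA _ (d_bounded_uniform M_gt0 small_pl).
rewrite expected_revenue // lee_fin => le_rev.
have := OPT_uniform M_gt0 plP; rewrite size_pl card_ord => le_OPT.
rewrite card_ord -/r in load_pl.
(* The lower bound on [OPT] may be scaled by [c] since c > r >= 0. *)
have := ler_wpM2l (ltW (le_lt_trans r_ge0 hc)) le_OPT.
have := ler_wpM2l (ltW M_gt0) load_pl.
have MN : M * (N%:R * (c - r)) = `|a| + 1 by rewrite divfK // mulf_neq0 ?gt_eqF.
have := ler_norm a.
move: MN le_rev; lra.
Qed.
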